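(* There is an algorithm that solves the FIFO Stack-Up problem for every instance $I$ in time $O(|I|\cdot (4n^2+1)^{O(n^2)})$.
   Context: FIFO Stack-Up problem. An instance $I$ consists of a list $Q=(q_1,\ldots,q_k)$ of sequences of pairwise distinct bins, a pallet symbol ${\it plt}(b)$ (a positive integer) for every bin $b$, and a positive integer $p$; numbers are encoded in binary and $|I|$ denotes the instance size. Standing assumption: every pallet symbol that occurs is carried by at least two bins. $n$ is the total number of bins. A configuration is a tuple $(i_1,\ldots,i_k)$ with $0\le i_j\le |q_j|$, meaning that the first $i_j$ bins of $q_j$ have been removed. A pallet $t$ is open in configuration $(i_1,\ldots,i_k)$ if there are indices $j,\ell$ such that some bin for $t$ is at a position $\le i_j$ in $q_j$ and some bin for $t$ is at a position $> i_\ell$ in $q_\ell$. A transformation step removes the bin at position $i_j+1$ of some sequence $q_j$ (with $i_j<|q_j|$). A processing of $Q$ is a sequence of transformation steps from $(0,\ldots,0)$ to $(|q_1|,\ldots,|q_k|)$. The question is whether there is a processing of $Q$ such that in each configuration during the processing at most $p$ pallets are open. *)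

(* Defs.v *)
From mathcomp Require Import all_boot.

Set Implicit Arguments.
Unset Strict Implicit.
Unset Printing Implicit Defensive.

(** * The FIFO Stack-Up problem *)

Record fifo_instance := FifoInstance {
  bin : eqType;
  seqs : seq (seq bin);
  plt : bin -> nat;
  places : nat;  (* the bound p on the number of open pallets *)
  bins_uniq : uniq (flatten seqs);
  plt_gt0 : {in flatten seqs, forall b, 0 < plt b};
  plt_ge2 : {in flatten seqs, forall b,
    2 <= count (fun b' => plt b' == plt b) (flatten seqs)};
  places_gt0 : 0 < places
}.

Section StackUp.
Variable I : fifo_instance.

Definition nseqs : nat := size (seqs I).
Definition sequence (j : 'I_nseqs) : seq (bin I) := nth [::] (seqs I) j.
Definition nbins : nat := size (flatten (seqs I)).

(* The bound [c j <= size (sequence j)] is not part of the type: it holds for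
   [start], and [step] preserves it. *)
Definition config := {ffun 'I_nseqs -> nat}.

Definition start : config := [ffun => 0].
Definition finish : config := [ffun j => size (sequence j)].

(* Positions count from 1: the bins of a sequence q at a position <= i are those
   of [take i q], the bins at a position > i are those of [drop i q]. *)
Definition is_open (c : config) (t : nat) : bool :=
  [exists j, exists l,
     has (fun b => plt b == t) (take (c j) (sequence j)) &&
     has (fun b => plt b == t) (drop (c l) (sequence l))].

Definition pallets : seq nat := undup [seq plt b | b <- flatten (seqs I)].

Definition nopen (c : config) : nat := count (is_open c) pallets.

Definition step : rel config := fun c c' =>
  [exists j, (c j < size (sequence j)) &&
     (c' == [ffun i => if i == j then (c j).+1 else c i])].

(* [s] lists the configurations reached after each transformation step. *)
Definition processing (s : seq config) : bool :=
  path step start s && (last start s == finish).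

Definition stackup_solvable : Prop :=
  exists s : seq config,
    processing s /\ {in start :: s, forall c, nopen c <= places I}.

End StackUp.

(** * Random access machines with logarithmic cost *)

(* The machine of Aho, Hopcroft and Ullman (The Design and Analysis of Computer
   Algorithms, section 1.2) and its logarithmic cost criterion (section 1.3), over
   natural numbers with truncated subtraction and without MULT and DIV.  The
   program is fixed; cell 0 is the accumulator; the input is a read-only tape of
   numbers, scanned once from left to right; a decision is given by the
   halting instruction. *)

Inductive address :=
  | Dir of nat     (* i  : cell i *)
  | Ind of nat.    (* *i : the cell whose index is stored in cell i *)

Inductive operand :=
  | Lit of nat     (* =i : the number i itself *)
  | Cell of address.

Inductive instr :=
  | LOAD of operand
  | STORE of address
  | ADD of operand
  | SUB of operand
  | READ of address
  | JUMP of nat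
  | JGTZ of nat
  | JZERO of nat
  | HALT of bool.

Definition program := seq instr.

Record state := State { pc : nat; mem : nat -> nat; input : seq nat }.

Definition init (w : seq nat) : state := State 0 (fun=> 0) w.

Definition target (m : nat -> nat) (a : address) : nat :=
  match a with Dir i => i | Ind i => m i end.

Definition value (m : nat -> nat) (o : operand) : nat :=
  match o with Lit i => i | Cell a => m (target m a) end.

Definition set_mem (m : nat -> nat) (i v : nat) : nat -> nat :=
  fun j => if j == i then v else m j.

(* Beyond its end the input tape reads as 0. *)
Definition next (i : instr) (s : state) : option state :=
  let: State pc m w := s in
  match i with
  | LOAD o => Some (State pc.+1 (set_mem m 0 (value m o)) w)
  | STORE a => Some (State pc.+1 (set_mem m (target m a) (m 0)) w)
  | ADD o => Some (State pc.+1 (set_mem m 0 (m 0 + value m o)) w)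
  | SUB o => Some (State pc.+1 (set_mem m 0 (m 0 - value m o)) w)
  | READ a => Some (State pc.+1 (set_mem m (target m a) (head 0 w)) (behead w))
  | JUMP l => Some (State l m w)
  | JGTZ l => Some (State (if 0 < m 0 then l else pc.+1) m w)
  | JZERO l => Some (State (if m 0 == 0 then l else pc.+1) m w)
  | HALT _ => None
  end.

(* Length of the binary representation, with [bitlen 0 = 1]. *)
Definition bitlen (x : nat) : nat := (trunc_log 2 x).+1.

Definition target_cost (m : nat -> nat) (a : address) : nat :=
  match a with Dir i => bitlen i | Ind i => bitlen i + bitlen (m i) end.

Definition operand_cost (m : nat -> nat) (o : operand) : nat :=
  match o with
  | Lit i => bitlen i
  | Cell a => target_cost m a + bitlen (m (target m a))
  end.

Definition cost (i : instr) (s : state) : nat :=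
  let: State _ m w := s in
  match i with
  | LOAD o => operand_cost m o
  | STORE a => bitlen (m 0) + target_cost m a
  | ADD o | SUB o => bitlen (m 0) + operand_cost m o
  | READ a => bitlen (head 0 w) + target_cost m a
  | JUMP _ => 1
  | JGTZ _ | JZERO _ => bitlen (m 0)
  | HALT _ => 1
  end.

(* [runs P s b t]: from [s], [P] halts with decision [b] after total cost [t].
   A program counter outside [P] is stuck and does not halt. *)
Inductive runs (P : program) : state -> bool -> nat -> Prop :=
  | RunsHalt s b :
      onth P (pc s) = Some (HALT b) -> runs P s b (cost (HALT b) s)
  | RunsStep s i s' b t :
      onth P (pc s) = Some i -> next i s = Some s' ->
      runs P s' b t -> runs P s b (cost i s + t).

(** * Encoding of instances *)

(* The number of places, then each sequence announced by 1, given by the pallet symbols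
   of its bins in order and closed by 0 (which is not a pallet symbol), then a
   final 0.  Bins are identified by their position. *)
Definition encode (I : fifo_instance) : seq nat :=
  places I ::
    flatten [seq 1 :: rcons [seq plt b | b <- q] 0 | q <- seqs I] ++ [:: 0].

Definition instance_size (I : fifo_instance) : nat :=
  \sum_(x <- encode I) bitlen x.

(* Main.v *)
Require Import Defs.
From Stdlib Require Import FunctionalExtensionality.
From mathcomp Require Import all_boot zify.

Set Implicit Arguments.
Unset Strict Implicit.
Unset Printing Implicit Defensive.

(* A processing removes the [n] bins in some order, so depth-first search over
   the removal orders decides the problem.  Laid out with a [0] before each
   nonempty sequence, the pallets occupy at most [2 * n] cells, and a bin can be
   removed when the cell before it is a separator or has already been cleared;
   hence the search tree has at most [(2 * n + 1) ^ n] leaves.  Removing a bin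
   for [x] changes the number of open pallets by
   [- (x occurs among the removed bins) + (x occurs among the remaining ones)],
   which one scan of the layout computes.  Every cell value has at most
   [|I| + O(n)] bits, and empty sequences are read at constant cost and dropped,
   so the logarithmic cost is [|I|] times a function of [n]. *)

(** * Symbolic execution of random access machines *)

Lemma leq_bitlen : {homo bitlen : x y / x <= y}.
Proof. by move=> x y xy; rewrite /bitlen ltnS leq_trunc_log. Qed.

Lemma bitlen_gt0 x : 0 < bitlen x. Proof. by []. Qed.

Lemma bitlen_max x y : bitlen (maxn x y) <= bitlen x + bitlen y.
Proof. by case: (leqP x y) => _; rewrite ?leq_addl ?leq_addr. Qed.

Lemma bitlen_leS x : bitlen x <= x.+1.
Proof.
rewrite /bitlen ltnS; case: x => [|x]; first by rewrite trunc_log0.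
apply: leq_trans (_ : 2 ^ trunc_log 2 x.+1 <= _); first exact/ltnW/ltn_expl.
exact: trunc_logP.
Qed.

(** * Reachability with bounded cost *)

Section Reach.
Variable P : program.

(** Stated backwards: every halting run from [s'] extends to one from [s] with the same decision, at
    an extra cost that does not depend on that run. Pieces of execution then compose by adding their
    bounds. *)
Definition reach (t : nat) (s s' : state) : Prop :=
  exists2 t0, t0 <= t &
    forall b t', runs P s' b t' -> runs P s b (t0 + t').

Lemma reach_refl t s : reach t s s.
Proof. by exists 0. Qed.

Lemma reach_trans s2 t1 t2 s1 s3 :
  reach t1 s1 s2 -> reach t2 s2 s3 -> reach (t1 + t2) s1 s3.
Proof.
move=> [u1 le1 H1] [u2 le2 H2]; exists (u1 + u2); first exact: leq_add.
by move=> b t' /H2/H1; rewrite addnA.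
Qed.

Lemma reachW t t' s s' : t <= t' -> reach t s s' -> reach t' s s'.
Proof. by move=> le_t [u le_u H]; exists u => //; apply: leq_trans le_t. Qed.

Lemma reach_step i s s' :
  onth P (pc s) = Some i -> Defs.next i s = Some s' -> reach (cost i s) s s'.
Proof. by move=> Pi nexti; exists (cost i s) => // b t'; apply: RunsStep. Qed.

(** When all numbers involved are at most [B], an instruction costs at most four bit lengths: an
    indirect operand accounts for three (index, pointer, content) and the accumulator for one. *)
Definition nsteps (B k : nat) : state -> state -> Prop :=
  reach (4 * bitlen B * k).

Lemma nsteps_trans s2 B k1 k2 s1 s3 :
  nsteps B k1 s1 s2 -> nsteps B k2 s2 s3 -> nsteps B (k1 + k2) s1 s3.
Proof. by rewrite /nsteps mulnDr; apply: reach_trans. Qed.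

Lemma nstepsW B k k' s s' : k <= k' -> nsteps B k s s' -> nsteps B k' s s'.
Proof. by move=> le_k; apply: reachW; rewrite leq_mul2l le_k orbT. Qed.

Lemma nsteps_refl B k s : nsteps B k s s.
Proof. exact: reach_refl. Qed.

Lemma nsteps_step B k i s s1 s2 :
    onth P (pc s) = Some i -> Defs.next i s = Some s1 -> cost i s <= 4 * bitlen B ->
    nsteps B k s1 s2 ->
  nsteps B k.+1 s s2.
Proof.
move=> Pi nexti cost_i; rewrite /nsteps mulnS; apply: reach_trans.
exact/(reachW cost_i)/reach_step.
Qed.

End Reach.

(* Cells below [nreg] are registers; above them, record [i] consists of the four
   cells [ptr i + f], [f < 4]. *)
Definition nreg := 12.
Definition ptr (i : nat) : nat := nreg + 4 * i.

Definition fields : Type :=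
  (nat -> nat) * (nat -> nat) * (nat -> nat) * (nat -> nat).

Definition upd (f : nat -> nat) (i v : nat) : nat -> nat :=
  fun j => if j == i then v else f j.

Definition fget (F : fields) (f : nat) : nat -> nat :=
  let: (f0, f1, f2, f3) := F in
  match f with 0 => f0 | 1 => f1 | 2 => f2 | _ => f3 end.

Definition fset (F : fields) (f i v : nat) : fields :=
  let: (f0, f1, f2, f3) := F in
  match f with
  | 0 => (upd f0 i v, f1, f2, f3)
  | 1 => (f0, upd f1 i v, f2, f3)
  | 2 => (f0, f1, upd f2 i v, f3)
  | _ => (f0, f1, f2, upd f3 i v)
  end.

Definition mk (r : seq nat) (F : fields) : nat -> nat := fun x =>
  if x < nreg then nth 0 r x else fget F ((x - nreg) %% 4) ((x - nreg) %/ 4).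

Arguments ptr : simpl never.
Arguments mk : simpl never.
Arguments upd : simpl never.

Lemma mk_reg r F x : x < nreg -> mk r F x = nth 0 r x.
Proof. by rewrite /mk => ->. Qed.

Lemma mk_field r F i f : f < 4 -> mk r F (ptr i + f) = fget F f i.
Proof.
move=> lt_f; rewrite /mk /ptr.
have -> : (nreg + 4 * i + f < nreg) = false by lia.
have -> : nreg + 4 * i + f - nreg = i * 4 + f by lia.
by rewrite modnMDl modn_small // divnMDl // divn_small // addn0.
Qed.

Lemma set_mem_reg r F x v : x < nreg ->
  set_mem (mk r F) x v = mk (set_nth 0 r x v) F.
Proof.
move=> lt_x; apply: functional_extensionality => y; rewrite /set_mem /mk.
by rewrite nth_set_nth /=; case: eqP => [->|_] //; rewrite lt_x.
Qed.

Lemma set_mem_field r F i f v : f < 4 ->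
  set_mem (mk r F) (ptr i + f) v = mk r (fset F f i v).
Proof.
move=> lt_f; apply: functional_extensionality => y; rewrite /set_mem.
have [lt_y|le_y] := ltnP y nreg.
  by rewrite !mk_reg //; case: eqP => //; rewrite /ptr; lia.
have -> : y = ptr ((y - nreg) %/ 4) + (y - nreg) %% 4.
  by rewrite /ptr -addnA mulnC -divn_eq; lia.
set j := _ %/ 4; have lt_g : (y - nreg) %% 4 < 4 by rewrite ltn_mod.
move: (_ %% 4) lt_g => g lt_g; rewrite !mk_field //.
have -> : (ptr j + g == ptr i + f) = (j == i) && (g == f) by rewrite /ptr; lia.
case: F => [[[f0 f1] f2] f3].
case: eqP => [->|ne_ji] /=.
  by case: eqP => [->|]; move: f g lt_f lt_g => [|[|[|[|//]]]] [|[|[|[|//]]]] //=;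
    rewrite /upd eqxx.
by move: f g lt_f lt_g => [|[|[|[|//]]]] [|[|[|[|//]]]] //= _ _;
  rewrite /upd (introF eqP ne_ji).
Qed.

Lemma mk0 : (fun=> 0) = mk (nseq nreg 0) (fun=> 0, fun=> 0, fun=> 0, fun=> 0).
Proof.
apply: functional_extensionality => x; rewrite /mk nth_nseq.
by case: (x < nreg) => //; case: ((x - nreg) %% 4) => [|[|[|]]].
Qed.

(** * Symbolic rules for single instructions *)

Section Symbolic.
Variables (P : program) (B : nat).

Definition fetches (m : nat -> nat) (o : operand) (v : nat) : Prop :=
  value m o = v /\ operand_cost m o <= 3 * bitlen B.

Lemma fetch_lit m v : v <= B -> fetches m (Lit v) v.
Proof. by move=> /leq_bitlen le_v; split=> //=; lia. Qed.

Lemma fetch_reg r F x : x < nreg -> x <= B -> nth 0 r x <= B ->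
  fetches (mk r F) (Cell (Dir x)) (nth 0 r x).
Proof.
move=> lt_x /leq_bitlen le_x /leq_bitlen le_v; split=> /=; rewrite mk_reg //; lia.
Qed.

Lemma fetch_ind r F x i f : x < nreg -> nth 0 r x = ptr i + f -> f < 4 ->
    x <= B -> ptr i + f <= B -> fget F f i <= B ->
  fetches (mk r F) (Cell (Ind x)) (fget F f i).
Proof.
move=> lt_x rx lt_f /leq_bitlen le_x /leq_bitlen le_i /leq_bitlen le_v.
by split; rewrite /= (mk_reg _ _ lt_x) rx mk_field //; lia.
Qed.

Variables (l : nat) (a : nat) (r : seq nat) (F : fields) (w : seq nat).
Let s := State l (mk (a :: r) F) w.

Lemma set_acc v : set_mem (mk (a :: r) F) 0 v = mk (v :: r) F.
Proof. by rewrite set_mem_reg. Qed.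

(** This rule and the following ones keep the memory in the form [mk r F], so that code runs by
    computation on a list of registers and four functions. *)
Lemma sym_load o v k s' :
    onth P l = Some (LOAD o) -> fetches (mk (a :: r) F) o v ->
    nsteps P B k (State l.+1 (mk (v :: r) F) w) s' ->
  nsteps P B k.+1 s s'.
Proof.
move=> Pl [ov le_c]; apply: nsteps_step; [exact: Pl| |rewrite /=; lia].
by rewrite /= ov set_acc.
Qed.

Lemma sym_add o v k s' :
    onth P l = Some (ADD o) -> a <= B -> fetches (mk (a :: r) F) o v ->
    nsteps P B k (State l.+1 (mk (a + v :: r) F) w) s' ->
  nsteps P B k.+1 s s'.
Proof.
move=> Pl /leq_bitlen le_a [ov le_c].
apply: nsteps_step; [exact: Pl| |rewrite /= mk_reg //=; lia].
by rewrite /= ov set_acc mk_reg.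
Qed.

Lemma sym_sub o v k s' :
    onth P l = Some (SUB o) -> a <= B -> fetches (mk (a :: r) F) o v ->
    nsteps P B k (State l.+1 (mk (a - v :: r) F) w) s' ->
  nsteps P B k.+1 s s'.
Proof.
move=> Pl /leq_bitlen le_a [ov le_c].
apply: nsteps_step; [exact: Pl| |rewrite /= mk_reg //=; lia].
by rewrite /= ov set_acc mk_reg.
Qed.

Lemma sym_store x k s' :
    onth P l = Some (STORE (Dir x)) -> x < nreg -> x <= B -> a <= B ->
    nsteps P B k (State l.+1 (mk (set_nth 0 (a :: r) x a) F) w) s' ->
  nsteps P B k.+1 s s'.
Proof.
move=> Pl lt_x /leq_bitlen le_x /leq_bitlen le_a.
apply: nsteps_step; [exact: Pl| |rewrite /= mk_reg //=; lia].
by rewrite /= set_mem_reg // mk_reg.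
Qed.

Lemma sym_store_ind x i f k s' :
    onth P l = Some (STORE (Ind x)) -> x < nreg ->
    nth 0 (a :: r) x = ptr i + f -> f < 4 -> x <= B -> ptr i + f <= B -> a <= B ->
    nsteps P B k (State l.+1 (mk (a :: r) (fset F f i a)) w) s' ->
  nsteps P B k.+1 s s'.
Proof.
move=> Pl lt_x rx lt_f /leq_bitlen le_x /leq_bitlen le_i /leq_bitlen le_a.
apply: nsteps_step; [exact: Pl| |by rewrite /= !mk_reg //= rx; lia].
by rewrite /= (mk_reg _ _ lt_x) rx set_mem_field // mk_reg.
Qed.

Lemma sym_read x k s' :
    onth P l = Some (READ (Dir x)) -> x < nreg -> x <= B -> head 0 w <= B ->
    nsteps P B k (State l.+1 (mk (set_nth 0 (a :: r) x (head 0 w)) F) (behead w)) s' ->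
  nsteps P B k.+1 s s'.
Proof.
move=> Pl lt_x /leq_bitlen le_x /leq_bitlen le_w.
apply: nsteps_step; [exact: Pl| |rewrite /=; lia].
by rewrite /= set_mem_reg.
Qed.

Lemma sym_jump l' k s' :
    onth P l = Some (JUMP l') -> nsteps P B k (State l' (mk (a :: r) F) w) s' ->
  nsteps P B k.+1 s s'.
Proof.
move=> Pl; apply: nsteps_step; [exact: Pl|by []|].
by rewrite /=; have := bitlen_gt0 B; lia.
Qed.

Lemma sym_jgtz l' k s' :
    onth P l = Some (JGTZ l') -> a <= B ->
    nsteps P B k (State (if 0 < a then l' else l.+1) (mk (a :: r) F) w) s' ->
  nsteps P B k.+1 s s'.
Proof.
move=> Pl /leq_bitlen le_a.
by apply: nsteps_step; [exact: Pl| |rewrite /= mk_reg //=; lia].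
Qed.

Lemma sym_jzero l' k s' :
    onth P l = Some (JZERO l') -> a <= B ->
    nsteps P B k (State (if a == 0 then l' else l.+1) (mk (a :: r) F) w) s' ->
  nsteps P B k.+1 s s'.
Proof.
move=> Pl /leq_bitlen le_a.
by apply: nsteps_step; [exact: Pl| |rewrite /= mk_reg //=; lia].
Qed.

End Symbolic.

(** * The program *)

(* Registers: 0 accumulator; 1 scratch address; 2 bound [p]; 3 end of the layout;
   4 last level; 5 current level; 6 position tried; 7 its pallet [x]; 8 number of
   open pallets; 9, 10 whether [x] occurs among the removed, remaining bins;
   11 scanning position.
   Fields of record [i]: 0 pallet of the bin at position [i] if it remains, else
   [0]; 1 that pallet if the bin was removed, else [0]; 2 position chosen at
   level [i]; 3 number of open pallets at level [i]. *)
Definition pc_seq := 4.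
Definition pc_bin := 13.
Definition pc_main := 25.
Definition pc_enter := 27.
Definition pc_loop := 35.
Definition pc_scan := 57.
Definition pc_rest := 71.
Definition pc_advance := 79.
Definition pc_descend := 83.
Definition pc_back := 105.
Definition pc_next := 123.
Definition pc_accept := 130.
Definition pc_reject := 131.

(** Pointers are kept as cell addresses [ptr i], since the machine does not multiply; the next
    record is 4 cells further. Equality is tested by two truncated subtractions, and a zero
    difference tests [<=]. *)
Definition stackup_ram : program := [::
    READ (Dir 2); LOAD (Lit (ptr 0)); STORE (Dir 3); STORE (Dir 4);
  (* seq: *)
    READ (Dir 7); LOAD (Cell (Dir 7)); JZERO pc_main; READ (Dir 7);
    LOAD (Cell (Dir 7)); JZERO pc_seq; LOAD (Cell (Dir 3)); ADD (Lit 4);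
    STORE (Dir 3);
  (* bin: *)
    LOAD (Cell (Dir 7)); STORE (Ind 3); LOAD (Cell (Dir 3)); ADD (Lit 4);
    STORE (Dir 3); LOAD (Cell (Dir 4)); ADD (Lit 4); STORE (Dir 4);
    READ (Dir 7); LOAD (Cell (Dir 7)); JGTZ pc_bin; JUMP pc_seq;
  (* main: *)
    LOAD (Lit (ptr 0)); STORE (Dir 5);
  (* enter: *)
    LOAD (Cell (Dir 4)); SUB (Cell (Dir 5)); JZERO pc_accept;
    LOAD (Cell (Dir 5)); ADD (Lit 2); STORE (Dir 1); LOAD (Lit (ptr 0));
    STORE (Ind 1);
  (* loop: *)
    LOAD (Cell (Dir 5)); ADD (Lit 2); STORE (Dir 1); LOAD (Cell (Ind 1));
    STORE (Dir 6); LOAD (Cell (Dir 3)); SUB (Cell (Dir 6)); JZERO pc_back;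
    LOAD (Cell (Ind 6)); STORE (Dir 7); JZERO pc_next; LOAD (Cell (Dir 6));
    SUB (Lit 4); STORE (Dir 1); LOAD (Cell (Ind 1)); JGTZ pc_next;
    LOAD (Lit 0); STORE (Ind 6); STORE (Dir 9); STORE (Dir 10);
    LOAD (Lit (ptr 0)); STORE (Dir 11);
  (* scan: *)
    LOAD (Cell (Dir 3)); SUB (Cell (Dir 11)); JZERO pc_descend;
    LOAD (Cell (Dir 11)); ADD (Lit 1); STORE (Dir 1); LOAD (Cell (Ind 1));
    SUB (Cell (Dir 7)); JGTZ pc_rest; LOAD (Cell (Dir 7));
    SUB (Cell (Ind 1)); JGTZ pc_rest; LOAD (Lit 1); STORE (Dir 9);
  (* rest: *)
    LOAD (Cell (Ind 11)); SUB (Cell (Dir 7)); JGTZ pc_advance;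
    LOAD (Cell (Dir 7)); SUB (Cell (Ind 11)); JGTZ pc_advance; LOAD (Lit 1);
    STORE (Dir 10);
  (* advance: *)
    LOAD (Cell (Dir 11)); ADD (Lit 4); STORE (Dir 11); JUMP pc_scan;
  (* descend: *)
    LOAD (Cell (Dir 6)); ADD (Lit 1); STORE (Dir 1); LOAD (Cell (Dir 7));
    STORE (Ind 1);
    LOAD (Cell (Dir 5)); ADD (Lit 3); STORE (Dir 1); LOAD (Cell (Ind 1));
    SUB (Cell (Dir 9)); ADD (Cell (Dir 10)); STORE (Dir 8);
    LOAD (Cell (Dir 5)); ADD (Lit 4); STORE (Dir 5); ADD (Lit 3);
    STORE (Dir 1); LOAD (Cell (Dir 8)); STORE (Ind 1);
    SUB (Cell (Dir 2)); JGTZ pc_back; JUMP pc_enter;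
  (* back: *)
    LOAD (Cell (Dir 5)); SUB (Lit (ptr 0)); JZERO pc_reject;
    LOAD (Cell (Dir 5)); SUB (Lit 4); STORE (Dir 5);
    ADD (Lit 2); STORE (Dir 1); LOAD (Cell (Ind 1)); STORE (Dir 6);
    ADD (Lit 1); STORE (Dir 1); LOAD (Cell (Ind 1)); STORE (Dir 7);
    LOAD (Lit 0); STORE (Ind 1); LOAD (Cell (Dir 7)); STORE (Ind 6);
  (* next: *)
    LOAD (Cell (Dir 5)); ADD (Lit 2); STORE (Dir 1); LOAD (Cell (Dir 6));
    ADD (Lit 4); STORE (Ind 1); JUMP pc_loop;
  (* accept: *)
    HALT true;
  (* reject: *)
    HALT false
  ].

(** * Tactics for symbolic execution *)

Lemma ptrS i : ptr i + 4 = ptr i.+1.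
Proof. by rewrite /ptr; lia. Qed.

Lemma ptr_subS i : 0 < i -> ptr i - 4 = ptr i.-1.
Proof. by rewrite /ptr; lia. Qed.

Ltac bound := rewrite /=; first
  [ by [] | by eauto 2 | by apply: leq_trans (leq_subr _ _) _; eauto 2
  | by rewrite /ptr /nreg; lia].

Ltac fetch := first
  [ apply: fetch_lit; bound
  | apply: fetch_reg; [by [] | bound | bound]
  | eapply fetch_ind; [by [] | first [reflexivity | exact: esym (addn0 _)]
                      | by [] | bound | bound | bound] ].

(** Executes one instruction; the [reflexivity] on the fetched instruction selects the applicable
    rule. *)
Ltac sym := first
  [ eapply sym_load; [reflexivity | fetch |]
  | eapply sym_store; [reflexivity | by [] | bound | bound |]
  | eapply sym_add; [reflexivity | bound | fetch |]
  | eapply sym_sub; [reflexivity | bound | fetch |]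
  | eapply sym_jzero; [reflexivity | bound |]
  | eapply sym_jgtz; [reflexivity | bound |]
  | eapply sym_jump; [reflexivity |]
  | eapply sym_read; [reflexivity | by [] | bound | bound |]
  | eapply sym_store_ind; [reflexivity | by []
                          | first [reflexivity | exact: esym (addn0 _)]
                          | by [] | bound | bound | bound |] ]; rewrite /=.

(** * The depth-first search phase *)

Section Search.
Variables (B L n p : nat) (w : seq nat).
Hypothesis le_LB : ptr L + 4 <= B.
Hypothesis le_nL : n <= L.
Hypothesis le_pB : p <= B.

Let go := nsteps stackup_ram B.
Let le_LB' : 16 + 4 * L <= B.
Proof. by move: le_LB; rewrite /ptr /nreg; lia. Qed.


(** Induction on the number [k] of positions left; the flags [e] and [l] accumulate. A round takes
    at most 14 instructions for the removed bin, 8 for the remaining one and 4 to advance; the last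
    3 are the exit test. *)
Lemma scan_loop (rem don D C : nat -> nat) t i x c k :
    (forall j, rem j <= B) -> (forall j, don j <= B) -> x <= B -> k <= L ->
  forall (a t1 : nat) (e l : bool), exists a' t1',
  go (26 * k + 3)
    (State pc_scan (mk [:: a; t1; p; ptr L; ptr n; ptr t; ptr i; x; c;
                           nat_of_bool e; nat_of_bool l; ptr (L - k)]
                       (rem, don, D, C)) w)
    (State pc_descend (mk [:: a'; t1'; p; ptr L; ptr n; ptr t; ptr i; x; c;
         nat_of_bool (e || has (fun j => don j == x) (iota (L - k) k));
         nat_of_bool (l || has (fun j => rem j == x) (iota (L - k) k)); ptr L]
                       (rem, don, D, C)) w).
Proof.
move=> le_rem le_don le_x; elim: k => [|k IHk] le_k a t1 e l.
  rewrite subn0 /= !orbF; exists 0, t1.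
  rewrite [26 * 0 + 3]/=; do 3 sym.
  by rewrite subnn; apply: nsteps_refl.
set j := L - k.+1; have jS : L - k = j.+1 by rewrite /j; lia.
have {IHk}IH := IHk (ltnW le_k); rewrite jS in IH.
rewrite /= -/j !orbA.
have lt_jL : j < L by rewrite /j; lia.
have [a' [t1' IHj]] := IH (ptr j.+1) (ptr j + 1) (e || (don j == x)) (l || (rem j == x)).
exists a', t1'; rewrite [26 * _ + 3](_ : _ = 14 + (12 + (26 * k + 3))); last lia.
have [a1 H1] : exists a1, go 14
    (State pc_scan (mk [:: a; t1; p; ptr L; ptr n; ptr t; ptr i; x; c;
                        nat_of_bool e; nat_of_bool l; ptr j] (rem, don, D, C)) w)
    (State pc_rest (mk [:: a1; ptr j + 1; p; ptr L; ptr n; ptr t; ptr i; x; c;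
       nat_of_bool (e || (don j == x)); nat_of_bool l; ptr j] (rem, don, D, C)) w).
  (* The accumulator depends on the exit taken: a positive difference, or the literal 1 on
     equality. *)
  exists (if x < don j then don j - x else if don j < x then x - don j else 1).
  do 3 sym.
  rewrite (_ : (ptr L - ptr j == 0) = false); last by rewrite /ptr; lia.
  do 6 sym.
  rewrite subn_gt0; case: (ltngtP x (don j)) => [_|gt_x|eq_x].
  - by rewrite orbF; apply: nsteps_refl.
  - by do 3 sym; rewrite subn_gt0 gt_x orbF; apply: nsteps_refl.
  - by do 3 sym; rewrite -eq_x subnn orbT; do 2 sym; apply: nsteps_refl.
apply: nsteps_trans H1 _.
have [a2 H2] : exists a2, go 8
    (State pc_rest (mk [:: a1; ptr j + 1; p; ptr L; ptr n; ptr t; ptr i; x; c;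
       nat_of_bool (e || (don j == x)); nat_of_bool l; ptr j] (rem, don, D, C)) w)
    (State pc_advance (mk [:: a2; ptr j + 1; p; ptr L; ptr n; ptr t; ptr i; x; c;
       nat_of_bool (e || (don j == x)); nat_of_bool (l || (rem j == x)); ptr j]
       (rem, don, D, C)) w).
  exists (if x < rem j then rem j - x else if rem j < x then x - rem j else 1).
  do 3 sym.
  rewrite subn_gt0; case: (ltngtP x (rem j)) => [_|gt_x|eq_x].
  - by rewrite orbF; apply: nsteps_refl.
  - by do 3 sym; rewrite subn_gt0 gt_x orbF; apply: nsteps_refl.
  - by do 3 sym; rewrite -eq_x subnn orbT; do 2 sym; apply: nsteps_refl.
rewrite -[12]/(8 + 4) -addnA; apply: nsteps_trans H2 _.
by rewrite -[4 + _]/((26 * k + 3).+4); do 4 sym; rewrite ptrS.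
Qed.

(** Between phases only the bound, the end of the layout, the last level and the current level
    matter; the other registers are scratch. *)
Definition at_level l t F (s : state) : Prop := exists a t1 i x c e f j,
  s = State l (mk [:: a; t1; p; ptr L; ptr n; ptr t; i; x; c; e; f; j] F) w.

(** For [i = 0] the two conditions contradict each other, so [i.-1] is a true predecessor whenever
    the test succeeds. *)
Definition removable (rem : nat -> nat) i := (0 < rem i) && (rem i.-1 == 0).

(** [don] is taken before the removal and [rem] after it, so one scan between the two updates yields
    both flags. The subtraction does not truncate when [c] counts the open pallets: a pallet with a
    removed bin and the bin at [i] is among them. *)
Definition nopen_after (rem don : nat -> nat) i c :=
  c - has (fun j => don j == rem i) (iota 0 L)
    + has (fun j => upd rem i 0 j == rem i) (iota 0 L).

Fixpoint search k (rem don : nat -> nat) c : bool :=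
  if k is k'.+1 then
    has (fun i =>
      let c' := nopen_after rem don i c in
      [&& removable rem i, c' <= p
        & search k' (upd rem i 0) (upd don i (rem i)) c']) (iota 0 L)
  else true.

Lemma updE f i v : upd f i v i = v.
Proof. by rewrite /upd eqxx. Qed.

Lemma upd_id f i v u : f i = v -> upd (upd f i u) i v = f.
Proof.
by move=> <-; apply: functional_extensionality => j; rewrite /upd; case: eqP => [->|].
Qed.

Lemma leq_upd f i v : (forall j, f j <= B) -> v <= B -> forall j, upd f i v j <= B.
Proof. by move=> le_f le_v j; rewrite /upd; case: eqP. Qed.

Lemma enter_full F s : at_level pc_enter n F s ->
  exists2 s', go 3 s s' & pc s' = pc_accept.
Proof.
move=> [a [t1 [i [x [c [e [f [j ->]]]]]]]].
eexists; first by do 3 sym; apply: nsteps_refl.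
by rewrite /= subnn.
Qed.

Lemma enter_loop t rem don D C s : t < n -> at_level pc_enter t (rem, don, D, C) s ->
  exists2 s', go 8 s s' & at_level pc_loop t (rem, don, upd D t (ptr 0), C) s'.
Proof.
move=> lt_tn [a [t1 [i [x [c [e [f [j ->]]]]]]]].
eexists.
  do 3 sym.
  rewrite (_ : ptr n - ptr t == 0 = false); last by rewrite /ptr; lia.
  by do 5 sym; apply: nsteps_refl.
by do 8 eexists.
Qed.

Lemma loop_end t rem don D C s :
    t < n -> D t = ptr L -> at_level pc_loop t (rem, don, D, C) s ->
  exists2 s', go 8 s s' & at_level pc_back t (rem, don, D, C) s'.
Proof.
move=> lt_tn Dt [a [t1 [i [x [c [e [f [j ->]]]]]]]].
have le_Dt : D t <= B by rewrite Dt; bound.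
eexists; first by do 8 sym; rewrite Dt subnn; apply: nsteps_refl.
by do 8 eexists.
Qed.

Lemma loop_skip t i rem don D C s :
    t < n -> i < L -> rem 0 = 0 -> (forall j, rem j <= B) -> D t = ptr i ->
    ~~ removable rem i -> at_level pc_loop t (rem, don, D, C) s ->
  exists2 s', go 23 s s' & at_level pc_loop t (rem, don, upd D t (ptr i.+1), C) s'.
Proof.
move=> lt_tn lt_iL rem0 le_rem Dt nrem [a [t1 [i0 [x [c [e [f [j ->]]]]]]]].
have le_Dt : D t <= B by rewrite Dt; bound.
have lt_LiF : ptr L - ptr i == 0 = false by rewrite /ptr; lia.
have [ri0|ri_gt0] := posnP (rem i).
  eexists.
    do 8 sym; rewrite Dt lt_LiF.
    do 3 sym; rewrite ri0 /=.
    by do 7 sym; rewrite ptrS; apply: nsteps_refl.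
  by do 8 eexists.
(* For [i = 0] the preceding record would fall among the registers. *)
have i_gt0 : 0 < i by case: (i) ri_gt0; rewrite ?rem0.
move: nrem; rewrite /removable ri_gt0 -lt0n => rp_gt0.
eexists.
  do 8 sym; rewrite Dt lt_LiF.
  do 3 sym; rewrite (gtn_eqF ri_gt0).
  do 3 sym; rewrite (ptr_subS i_gt0).
  do 2 sym; rewrite rp_gt0.
  by do 7 sym; rewrite ptrS; apply: nsteps_refl.
by do 8 eexists.
Qed.

Lemma jump_enter (b : bool) k a r F :
  go k.+1 (State (if ~~ b then pc_back else pc_descend.+1.+4.+4.+4.+4.+4)
                 (mk (a :: r) F) w)
       (State (if b then pc_enter else pc_back) (mk (a :: r) F) w).
Proof. by case: b; [sym; apply: nsteps_refl | apply: nsteps_refl]. Qed.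

(** A removal opens at most one pallet, so [C t <= t] persists along the levels and keeps the
    counter below [B]. *)
Lemma loop_take t i rem don D C s :
    t < n -> i < L -> rem 0 = 0 -> (forall j, rem j <= B) ->
    (forall j, don j <= B) -> D t = ptr i -> C t <= t ->
    removable rem i -> at_level pc_loop t (rem, don, D, C) s ->
  let c' := nopen_after rem don i (C t) in
  exists2 s', go (26 * L + 50) s s' &
    at_level (if c' <= p then pc_enter else pc_back) t.+1
      (upd rem i 0, upd don i (rem i), D, upd C t.+1 c') s'.
Proof.
move=> lt_tn lt_iL rem0 le_rem le_don Dt le_C /andP[ri_gt0 rp0].
move=> [a [t1 [i0 [x [c [e [f [j ->]]]]]]]] c'.
have le_Dt : D t <= B by rewrite Dt; bound.
have lt_LiF : ptr L - ptr i == 0 = false by rewrite /ptr; lia.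
have i_gt0 : 0 < i by case: (i) ri_gt0; rewrite ?rem0.
have le_Ct : C t <= B by move: le_LB'; lia.
have le_c' : c' <= t.+1 by rewrite /c' /nopen_after; do 2 case: (has _ _) => /=; lia.
have le_rem' : forall j, upd rem i 0 j <= B by exact: leq_upd.
have [a' [t1' Hscan]] := scan_loop D C t i c le_rem' le_don (le_rem i) (leqnn L)
   (ptr 0) (ptr i.-1) false false.
rewrite subnn in Hscan.
eexists.
  rewrite [_ + 50](_ : _ = 22 + (26 * L + 3 + 25)); last lia.
  apply: nsteps_trans.
    do 8 sym; rewrite Dt lt_LiF.
    do 3 sym; rewrite (gtn_eqF ri_gt0).
    do 3 sym; rewrite (ptr_subS i_gt0).
    do 2 sym; rewrite (eqP rp0) /=.
    by do 6 sym; apply: nsteps_refl.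
  apply: nsteps_trans Hscan _; rewrite !orFb.
  do 11 sym.
  rewrite -/(nopen_after rem don i (C t)) -/c'.
  have le_c'B : c' <= B by move: le_LB'; lia.
  move: c' le_c' le_c'B => c' _ le_c'B; do 3 sym; rewrite ptrS; do 5 sym.
  do 2 sym; rewrite subn_gt0 ltnNge.
  exact: jump_enter.
by do 8 eexists.
Qed.

Lemma back_loop t i rem don D C s :
    t < n -> i < L -> (forall j, rem j <= B) -> (forall j, don j <= B) ->
    D t = ptr i -> at_level pc_back t.+1 (rem, don, D, C) s ->
  exists2 s', go 25 s s' &
    at_level pc_loop t (upd rem i (don i), upd don i 0, upd D t (ptr i.+1), C) s'.
Proof.
move=> lt_tn lt_iL le_rem le_don Dt [a [t1 [i0 [x [c [e [f [j ->]]]]]]]].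
have le_Dt : D t <= B by rewrite Dt; bound.
eexists.
  do 3 sym.
  do 2 sym; rewrite (ptr_subS (ltn0Sn t)) /=.
  do 5 sym; rewrite Dt.
  do 8 sym.
  by do 7 sym; rewrite ptrS; apply: nsteps_refl.
by do 8 eexists.
Qed.

Lemma back_reject F s : at_level pc_back 0 F s ->
  exists2 s', go 3 s s' & pc s' = pc_reject.
Proof.
move=> [a [t1 [i [x [c [e [f [j ->]]]]]]]].
by eexists; first by do 3 sym; apply: nsteps_refl.
Qed.

(** 16 is 8 for entering a level and 8 for leaving its exhausted loop. Each position costs a scan,
    at most 50 further instructions to try it, 25 to undo it, and the recursive search. *)
Fixpoint search_time k :=
  if k is k'.+1 then 16 + L * (26 * L + 75 + search_time k') else 3.

(** A failed search has to restore [rem] and [don] and to preserve the choices of the earlier levels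
    and the counts up to level [t], so that the caller can go on. *)
Definition outcome t (found : bool) rem don D C s : Prop :=
  if found then pc s = pc_accept else
  exists D' C', [/\ forall i, i < t -> D' i = D i, forall i, i <= t -> C' i = C i
    & at_level pc_back t (rem, don, D', C') s].

(** The last clause lets backtracking reset [don i] to 0: that was its value before the removal. *)
Definition legal (rem don : nat -> nat) : Prop :=
  [/\ rem 0 = 0, forall j, rem j <= B, forall j, don j <= B
    & forall j, 0 < rem j -> don j = 0].

Lemma legal_take rem don i : legal rem don -> 0 < rem i ->
  legal (upd rem i 0) (upd don i (rem i)).
Proof.
case=> rem0 le_rem le_don dis ri_gt0; split=> [|||j]; rewrite /upd.
- by rewrite rem0; case: eqP.
- exact: leq_upd.
- exact: leq_upd.
by case: eqP => // _; apply: dis.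
Qed.

(** Induction on the number [k] of bins left; inside it, induction on the number of positions still
    to be tried. *)
Lemma search_run k rem don D C s : k <= n ->
    legal rem don -> C (n - k) <= n - k ->
    at_level pc_enter (n - k) (rem, don, D, C) s ->
  exists2 s', go (search_time k) s s' &
    outcome (n - k) (search k rem don (C (n - k))) rem don D C s'.
Proof.
elim: k rem don D C s => [|k IHk] rem don D C s le_kn leg le_C s_enter.
  by rewrite subn0 in s_enter *; exact: enter_full s_enter.
set t := n - k.+1 in s_enter le_C *; have tS : n - k = t.+1 by rewrite /t; lia.
have lt_tn : t < n by rewrite /t; lia.
rewrite tS in IHk; have [rem0 le_rem le_don dis] := leg.
have [s1 go1 s1_loop] := enter_loop lt_tn s_enter.
pose good i := let c' := nopen_after rem don i (C t) in
  [&& removable rem i, c' <= p & search k (upd rem i 0) (upd don i (rem i)) c'].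
(* Loop invariant: [q] positions remain to be tried, and the pointer of level [t] is at the first of
   them. *)
suff loop q D1 C1 s2 : q <= L -> D1 t = ptr (L - q) -> C1 t = C t ->
    at_level pc_loop t (rem, don, D1, C1) s2 ->
  exists2 s3, go (8 + q * (26 * L + 75 + search_time k)) s2 s3 &
    outcome t (has good (iota (L - q) q)) rem don D1 C1 s3.
  have [||s2 go2] := loop L _ C s1 (leqnn L) _ _ s1_loop; rewrite ?updE ?subnn //.
  rewrite -/good => out2; exists s2.
    by rewrite /= -[16]/(8 + 8) -addnA; apply: nsteps_trans go1 go2.
  rewrite /search -/search -/good; move: out2; rewrite /outcome.
  case: (has _ _) => // -[D' [C' [eqD eqC ats2]]].
  exists D', C'; split=> // i lt_it; rewrite eqD // /upd.
  by rewrite (ltn_eqF lt_it).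
elim: q D1 C1 s2 => [|q IHq] D1 C1 s2 le_qL D1t C1t s2_loop.
  rewrite subn0 in D1t; have [s3 go3 s3_back] := loop_end lt_tn D1t s2_loop.
  by exists s3 => //; exists D1, C1.
set i := L - q.+1 in D1t *; have iS : L - q = i.+1 by rewrite /i; lia.
have lt_iL : i < L by rewrite /i; lia.
have {}IHq D2 C2 s3 := IHq D2 C2 s3 (ltnW le_qL); rewrite iS in IHq.
(* Every failure at [i] ends in [loop] with the pointer moved to [i.+1], where the inner induction
   hypothesis takes over. *)
have next_i : forall m D2 C2 s3, m <= 26 * L + 75 + search_time k ->
    go m s2 s3 -> ~~ good i -> (forall j, j < t -> D2 j = D1 j) ->
    (forall j, j <= t -> C2 j = C1 j) ->
    at_level pc_loop t (rem, don, upd D2 t (ptr i.+1), C2) s3 ->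
  exists2 s4, go (8 + q.+1 * (26 * L + 75 + search_time k)) s2 s4 &
    outcome t (has good (iota i q.+1)) rem don D1 C1 s4.
  move=> m D2 C2 s3 le_m go3 /negPf bad eqD eqC s3_loop.
  have [|s4 go4 out4] := IHq _ C2 s3 (updE _ _ _) _ s3_loop.
    by rewrite eqC.
  exists s4.
    by apply: nstepsW (nsteps_trans go3 go4); rewrite mulSn; lia.
  rewrite /= bad /=; move: out4; rewrite /outcome; case: (has _ _) => //.
  move=> [D' [C' [eqD' eqC' ats4]]]; exists D', C'; split=> // j lt_jt.
    by rewrite eqD' // /upd (ltn_eqF lt_jt) eqD.
  by rewrite eqC' // eqC.
have [rem_i|nrem_i] := boolP (removable rem i); last first.
  have [s3 go3 s3_loop] := loop_skip lt_tn lt_iL rem0 le_rem D1t nrem_i s2_loop.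
  by apply: next_i go3 _ _ _ s3_loop; rewrite ?/good ?(negPf nrem_i) //; lia.
have ri_gt0 : 0 < rem i by case/andP: rem_i.
have leg' := legal_take leg ri_gt0; have [_ le_rem' le_don' _] := leg'.
have le_C1 : C1 t <= t by rewrite C1t.
have [s3 go3] := loop_take lt_tn lt_iL rem0 le_rem le_don D1t le_C1 rem_i s2_loop.
(* The two failures after a removal, an exceeded bound and an unsuccessful deeper search, first pass
   through [back], which undoes it. *)
have back_i s4 D2 C2 m : m <= 26 * L + 50 + search_time k -> go m s2 s4 ->
    ~~ good i -> (forall j, j < t.+1 -> D2 j = D1 j) ->
    (forall j, j <= t -> C2 j = C1 j) ->
    at_level pc_back t.+1 (upd rem i 0, upd don i (rem i), D2, C2) s4 ->
  exists2 s5, go (8 + q.+1 * (26 * L + 75 + search_time k)) s2 s5 &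
    outcome t (has good (iota i q.+1)) rem don D1 C1 s5.
  move=> le_m go4 bad eqD eqC s4_back.
  have D2t : D2 t = ptr i by rewrite eqD.
  have [s5 go5] := back_loop lt_tn lt_iL le_rem' le_don' D2t s4_back.
  rewrite updE upd_id // upd_id ?dis // => s5_loop.
  apply: next_i (nsteps_trans go4 go5) bad _ _ s5_loop => //; first by lia.
  by move=> j lt_jt; apply: eqD; apply: ltnW.
have eq_upd c' j : j <= t -> upd C1 t.+1 c' j = C1 j.
  by move=> le_jt; rewrite /upd ltn_eqF.
rewrite C1t; set c' := nopen_after _ _ _ _.
have le_c' : c' <= t.+1.
  by rewrite /c' /nopen_after; do 2 case: (has _ _) => /=; lia.
have [le_c'p|lt_pc'] := leqP c' p => s3_at; last first.
  apply: back_i go3 _ _ _ s3_at => //; first lia.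
    by rewrite /good /= -/c' [c' <= p]leqNgt lt_pc' andbF.
  exact: eq_upd.
have [|s4 go4] := IHk _ _ _ _ _ (ltnW le_kn) leg' _ s3_at; rewrite updE //.
have eq_good : good i = search k (upd rem i 0) (upd don i (rem i)) c'.
  by rewrite /good /= -/c' rem_i le_c'p.
rewrite -eq_good; case good_i: (good i) => /= out4.
  exists s4; last by rewrite good_i.
  by apply: nstepsW (nsteps_trans go3 go4); rewrite mulSn; lia.
have [D' [C' [eqD eqC s4_back]]] := out4.
apply: back_i (nsteps_trans go3 go4) _ eqD _ s4_back; first by lia.
  by rewrite good_i.
by move=> j le_jt; rewrite eqC ?eq_upd // ltnW.
Qed.

End Search.

(** * Reading the tape *)

(* The pallets of a nonempty sequence are preceded by a [0]; empty sequences
   leave no trace, so that the layout has size at most [2 * n]. *)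
Definition block (q : seq nat) : seq nat := if q is [::] then [::] else 0 :: q.

Definition layout (Q : seq (seq nat)) : seq nat := flatten (map block Q).

Definition tape (Q : seq (seq nat)) : seq nat :=
  flatten [seq 1 :: rcons q 0 | q <- Q] ++ [:: 0].

Definition total_bitlen (s : seq nat) : nat := sumn (map bitlen s).

(** Cells past the end hold 0, the default of [nth], so a write to the first of them appends to the
    layout. *)
Lemma upd_size fl x : upd (nth 0 fl) (size fl) x = nth 0 (rcons fl x).
Proof.
apply: functional_extensionality => j; rewrite /upd nth_rcons.
by case: (ltngtP j (size fl)) => // lt_j; rewrite nth_default // ltnW.
Qed.

(** This is why a separator needs no write: advancing the end of the layout suffices. *)
Lemma nth_rcons0 (fl : seq nat) : nth 0 (rcons fl 0) = nth 0 fl.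
Proof.
apply: functional_extensionality => j; rewrite nth_rcons.
by case: (ltngtP j (size fl)) => // [lt_j|->]; rewrite nth_default // ltnW.
Qed.

Section Reading.
Variables (m p : nat).

Let M := bitlen (ptr m + 4).

(** The number [c] of bins is kept as an address too; it becomes the address of the last level. *)
Definition reading l a x fl c w := State l
  (mk [:: a; 0; p; ptr (size fl); ptr c; 0; 0; x; 0; 0; 0; 0]
      (nth 0 fl, fun=> 0, fun=> 0, fun=> 0)) w.

Lemma reachB B b k s s' : bitlen B <= b -> nsteps stackup_ram B k s s' ->
  reach stackup_ram (4 * b * k) s s'.
Proof. by move=> le_b; apply: reachW; rewrite leq_mul2r leq_mul2l le_b !orbT. Qed.

(** Each bin is charged its own bit length, once when read and once when stored, hence 96 against 48
    for [x], which has already been read. This makes the total linear in the tape. *)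
Lemma read_bins q : forall a x fl c w,
    0 < x -> all (leq 1) q -> size fl + (size q).+1 <= m -> c + (size q).+1 <= m ->
  exists a',
  reach stackup_ram
    (48 * bitlen x + 96 * total_bitlen q + 48 * M * (size q).+1 + 48)
    (reading pc_bin a x fl c (q ++ 0 :: w))
    (reading pc_seq a' 0 (fl ++ x :: q) (c + (size q).+1) w).
Proof.
elim: q => [|y q IHq] a x fl c w x_gt0 q_gt0 le_fl le_c.
  rewrite /= in le_fl le_c; exists 0; rewrite /reading.
  pose B := maxn x (ptr m + 4); have le_xB : x <= B by rewrite leq_maxl.
  have le_mB : ptr m + 4 <= B by rewrite leq_maxr.
  have le_mB' : 16 + 4 * m <= B by move: le_mB; rewrite /ptr /nreg; lia.
  apply: reachW (_ : 4 * (bitlen x + M) * 12 <= _) _; first by lia.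
  apply: (@reachB B); first exact: bitlen_max.
  rewrite cats1 size_rcons -upd_size addn1 /=.
  do 4 sym; rewrite ptrS; do 3 sym; rewrite ptrS; do 5 sym.
  exact: nsteps_refl.
case/andP: q_gt0 => y_gt0 q_gt0; rewrite /= in le_fl le_c.
have [||a' IH] := IHq y y (rcons fl x) c.+1 w y_gt0 q_gt0.
- by rewrite size_rcons; lia.
- by lia.
exists a'; rewrite /= cat_rcons addSnnS in IH *.
apply: reachW (_ : 4 * (bitlen x + (bitlen y + M)) * 12 + _ <= _) _; last first.
  apply: reach_trans IH; rewrite /reading size_rcons.
  pose B := maxn x (maxn y (ptr m + 4)).
  have le_xB : x <= B by rewrite leq_maxl.
  have le_yB : y <= B by rewrite /B !leq_max leqnn orbT.
  have le_mB : ptr m + 4 <= B by rewrite /B !leq_max leqnn !orbT.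
  have le_mB' : 16 + 4 * m <= B by move: le_mB; rewrite /ptr /nreg; lia.
  apply: (@reachB B).
    by apply: leq_trans (bitlen_max _ _) _; rewrite leq_add2l bitlen_max.
  rewrite -upd_size.
  do 4 sym; rewrite ptrS; do 3 sym; rewrite ptrS; do 4 sym.
  rewrite y_gt0; apply: nsteps_refl.
by rewrite /total_bitlen /=; lia.
Qed.

(** [M] depends only on the bound [m] on the layout. Empty sequences occupy no cell, so any number
    of them keeps the cost linear in the tape. *)
Lemma read_tape Q : forall a x fl c,
    all (all (leq 1)) Q -> size fl + size (layout Q) <= m ->
    c + size (flatten Q) <= m ->
  exists a',
  reach stackup_ram (96 * total_bitlen (tape Q) + 48 * M * size (tape Q))
    (reading pc_seq a x fl c (tape Q))
    (reading pc_main a' 0 (fl ++ layout Q) (c + size (flatten Q)) [::]).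
Proof.
elim: Q => [|q Q IHQ] a x fl c Q_gt0 le_fl le_c.
  have le_mB' : 16 + 4 * m <= ptr m + 4 by rewrite /ptr /nreg; lia.
  exists 0; rewrite cats0 addn0.
  apply: reachW (_ : 4 * M * 3 <= _) _; first by rewrite /=; lia.
  by rewrite /reading /tape; do 3 sym; apply: nsteps_refl.
case/andP: Q_gt0 => q_gt0 Q_gt0.
have tape_cons : tape (q :: Q) = 1 :: q ++ 0 :: tape Q.
  by rewrite /tape /= -!cats1 -!catA.
have le_mB : ptr m + 4 <= ptr m + 4 by [].
have le_mB' : 16 + 4 * m <= ptr m + 4 by rewrite /ptr /nreg; lia.
rewrite tape_cons; case: q => [|y q] in q_gt0 le_fl le_c tape_cons *.
  have [||a' IH] := IHQ 0 0 fl c Q_gt0; [by []|by []|].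
  exists a'; apply: reachW (_ : 4 * M * 6 + _ <= _) _; last first.
    apply: reach_trans IH; rewrite /reading.
    by do 6 sym; apply: nsteps_refl.
  by rewrite /total_bitlen /=; lia.
case/andP: q_gt0 => y_gt0 q_gt0.
have [||a1 IH1] := @read_bins q (ptr (size fl).+1) y (rcons fl 0) c (tape Q) y_gt0 q_gt0.
- by move: le_fl; rewrite size_rcons /layout /= size_cat; lia.
- by move: le_c; rewrite /= size_cat; lia.
have [||a' IH] := IHQ a1 0 (rcons fl 0 ++ y :: q) (c + (size q).+1) Q_gt0.
- by move: le_fl; rewrite size_cat size_rcons /layout /= size_cat /=; lia.
- by move: le_c; rewrite /= size_cat; lia.
exists a'.
have -> : fl ++ layout ((y :: q) :: Q) = (rcons fl 0 ++ y :: q) ++ layout Q.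
  by rewrite cat_rcons -catA.
have -> : c + size (flatten ((y :: q) :: Q)) = c + (size q).+1 + size (flatten Q).
  by rewrite /= size_cat; lia.
apply: reachW (_ : 4 * (bitlen y + M) * 9 + (_ + _) <= _) _; last first.
  apply: reach_trans (reach_trans IH1 IH).
  rewrite /reading size_rcons nth_rcons0.
  pose B := maxn y (ptr m + 4); have le_yB : y <= B by rewrite leq_maxl.
  have le_mB1 : ptr m + 4 <= B by rewrite leq_maxr.
  have le_mB2 : 16 + 4 * m <= B by move: le_mB1; rewrite /ptr /nreg; lia.
  have le_fl' : size fl < m.
    by move: le_fl; rewrite /layout /= size_cat; lia.
  apply: (@reachB B); first exact: bitlen_max.
  do 6 sym; rewrite (gtn_eqF y_gt0); do 3 sym.
  by rewrite ptrS; apply: nsteps_refl.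
rewrite /total_bitlen /= map_cat sumn_cat size_cat /=.
have := bitlen_gt0 0; have := bitlen_gt0 1; lia.
Qed.

End Reading.

(** * Configurations *)

(** The common count [m] away from [x] avoids a difference of counts. *)
Lemma count_distinguished (T : eqType) (s : seq T) (x : T) (a b : pred T) :
    uniq s -> x \in s -> (forall y, y \in s -> y != x -> a y = b y) ->
  exists m, count a s = a x + m /\ count b s = b x + m.
Proof.
move=> uniq_s s_x eq_ab; exists (count a (rem x s)).
have /permP count_s := perm_to_rem s_x; rewrite !count_s /=; split=> //.
congr (_ + _); apply: eq_in_count => y; rewrite mem_rem_uniq // inE.
by case/andP=> ne_yx s_y; rewrite eq_ab.
Qed.

Section Configurations.
Variable I : fifo_instance.

Let Q : seq (seq nat) := [seq [seq plt b | b <- q] | q <- seqs I].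
Let cells : nat -> nat := nth 0 (layout Q).
Let L := size (layout Q).
Let sh := shape (map block Q).

Implicit Types (c : config I) (j : 'I_(nseqs I)).

Definition removed_from c (j : nat) : nat := oapp c 0 (insub j).

(* Offset [0] of a block is its separator, so offset [o] is removed when
   [o <= c j]. *)
Definition gone c i :=
  reshape_offset sh i <= removed_from c (reshape_index sh i).
Definition rem_of c i := if gone c i then 0 else cells i.
Definition don_of c i := if gone c i then cells i else 0.

Definition pallet j o := nth 0 [seq plt b | b <- sequence j] o.
(** Offset [o] in a sequence is offset [o.+1] in its block, behind the separator. *)
Definition pos j o := flatten_index sh j o.+1.

Lemma removed_fromE c j : removed_from c j = c j.
Proof. by rewrite /removed_from valK. Qed.

Lemma nth_Q j : nth [::] Q j = [seq plt b | b <- sequence j].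
Proof. by rewrite (nth_map [::]) //; apply: ltn_ord. Qed.

Lemma nth_blocks j : nth [::] (map block Q) j = block [seq plt b | b <- sequence j].
Proof. by rewrite (nth_map [::]) ?nth_Q // size_map; apply: ltn_ord. Qed.

Lemma nth_sh j : nth 0 sh j = size (block [seq plt b | b <- sequence j]).
Proof. by rewrite (nth_map [::]) ?nth_blocks // !size_map; apply: ltn_ord. Qed.

Lemma size_cells : L = sumn sh. Proof. exact: size_flatten. Qed.

Lemma lt_sh j o : o < size (sequence j) -> o.+1 < nth 0 sh j.
Proof.
by rewrite nth_sh; case: (sequence j) => //= b q; rewrite size_map ltnS.
Qed.

Lemma cells_default i : L <= i -> cells i = 0.
Proof. by move=> le_Li; rewrite /cells nth_default. Qed.

Section Pos.
Variables (j : 'I_(nseqs I)) (o : nat).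
Hypothesis lt_o : o < size (sequence j).

Lemma index_pos : reshape_index sh (pos j o) = j.
Proof. by rewrite flatten_indexKl // lt_sh. Qed.

Lemma offset_pos : reshape_offset sh (pos j o) = o.+1.
Proof. by rewrite flatten_indexKr // lt_sh. Qed.

Lemma pos_lt : pos j o < L.
Proof. by rewrite size_cells flatten_indexP // lt_sh. Qed.

Lemma cells_pos : cells (pos j o) = pallet j o.
Proof.
rewrite /cells /layout nth_flatten -/sh index_pos offset_pos nth_blocks /pallet.
by case: (sequence j) lt_o.
Qed.

Lemma pallet_gt0 : 0 < pallet j o.
Proof.
rewrite /pallet; case def_q: (sequence j) lt_o => [//|b q] _.
rewrite -def_q (nth_map b) //; apply: plt_gt0; apply/flattenP.
by exists (sequence j); rewrite mem_nth.
Qed.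

Lemma gone_pos c : gone c (pos j o) = (o < c j).
Proof. by rewrite /gone index_pos offset_pos removed_fromE. Qed.

Lemma rem_pos c : rem_of c (pos j o) = if o < c j then 0 else pallet j o.
Proof. by rewrite /rem_of gone_pos cells_pos. Qed.

Lemma don_pos c : don_of c (pos j o) = if o < c j then pallet j o else 0.
Proof. by rewrite /don_of gone_pos cells_pos. Qed.

End Pos.

Lemma pos_inj j o j' o' : o < size (sequence j) -> o' < size (sequence j') ->
  pos j o = pos j' o' -> j = j' /\ o = o'.
Proof.
move=> lt_o lt_o' eq_pos; split.
  by apply: val_inj; rewrite /= -(index_pos lt_o) eq_pos index_pos.
by apply: succn_inj; rewrite -(offset_pos lt_o) eq_pos offset_pos.
Qed.

(** Separators and cells past the end hold 0, so a positive cell belongs to a bin. *)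
Lemma posP i : 0 < cells i ->
  exists j o, o < size (sequence j) /\ i = pos j o.
Proof.
move=> ci_gt0; have lt_iL : i < L.
  by rewrite ltnNge; apply: contraL ci_gt0 => /cells_default ->.
rewrite size_cells in lt_iL; have lt_j := reshape_indexP lt_iL.
have lt_o := reshape_offsetP lt_iL.
rewrite !size_map in lt_j; pose j : 'I_(nseqs I) := Ordinal lt_j.
have ij : reshape_index sh i = j by [].
move: ci_gt0; rewrite /cells /layout nth_flatten -/sh ij nth_blocks.
rewrite ij nth_sh in lt_o.
case def_o: (reshape_offset sh i) lt_o => [|o] lt_o; first by case: (map _ _).
exists j, o; split; last by rewrite /pos -ij -def_o reshape_indexK.
by move: lt_o; case: (sequence j) => //= b q; rewrite size_map ltnS.
Qed.

Lemma rem_gt0 c i : 0 < rem_of c i ->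
  exists j o, [/\ o < size (sequence j), c j <= o & i = pos j o].
Proof.
move=> ri_gt0; have /posP[j [o [lt_o def_i]]] : 0 < cells i.
  by move: ri_gt0; rewrite /rem_of; case: ifP.
exists j, o; split=> //; move: ri_gt0; rewrite def_i rem_pos //.
by case: (ltnP o (c j)).
Qed.

Lemma don_gt0 c i : 0 < don_of c i ->
  exists j o, [/\ o < size (sequence j), o < c j & i = pos j o].
Proof.
move=> di_gt0; have /posP[j [o [lt_o def_i]]] : 0 < cells i.
  by move: di_gt0; rewrite /don_of; case: ifP.
exists j, o; split=> //; move: di_gt0; rewrite def_i don_pos //.
by case: (ltnP o (c j)).
Qed.

(** The cell before the first bin is the separator; the one before bin [o.+1] is cleared exactly
    when [o < c j]. As the bin itself must remain, only the front bin qualifies. *)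
Lemma removable_pos c j o : o < size (sequence j) ->
  removable (rem_of c) (pos j o) = (o == c j).
Proof.
move=> lt_o; rewrite /removable rem_pos //; case: o => [|o] in lt_o *.
  case: (posnP (c j)) => [cj0|cj_gt0]; last by rewrite (ltn_eqF cj_gt0).
  rewrite pallet_gt0 //=.
  rewrite /rem_of /gone.
  have -> : (pos j 0).-1 = flatten_index sh j 0.
    by rewrite /pos /flatten_index addn1 addn0.
  rewrite flatten_indexKr; last exact: ltn_trans (lt_sh lt_o).
  by rewrite cj0.
have -> : (pos j o.+1).-1 = pos j o by rewrite /pos /flatten_index addnS.
rewrite (rem_pos (ltnW lt_o)).
case: (ltngtP o.+1 (c j)) => //= [lt_c|eq_c]; last by rewrite pallet_gt0.
by rewrite (gtn_eqF (pallet_gt0 (ltnW lt_o))) andbF.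
Qed.

(** Positivity of [t] matters: 0 marks the separators and the cleared cells. *)
Lemma has_rem c t : 0 < t ->
  has (fun i => rem_of c i == t) (iota 0 L)
  = [exists j, has (fun b => plt b == t) (drop (c j) (sequence j))].
Proof.
move=> t_gt0; apply/hasP/existsP => [[i _ /eqP ri]|[j /hasP[b q_b /eqP bt]]].
  have [j [o [lt_o le_co def_i]]] : exists j o,
    [/\ o < size (sequence j), c j <= o & i = pos j o] by apply: rem_gt0; rewrite ri.
  exists j; have : t \in [seq plt b | b <- drop (c j) (sequence j)].
    rewrite -ri def_i rem_pos // ltnNge le_co /= map_drop.
    apply/(nthP 0); exists (o - c j); last by rewrite nth_drop subnKC.
    by rewrite size_drop size_map ltn_sub2r // (leq_ltn_trans le_co).
  by case/mapP=> b q_b ->; apply/hasP; exists b.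
have : t \in drop (c j) [seq plt b | b <- sequence j].
  by rewrite -map_drop -bt map_f.
case/(nthP 0)=> o; rewrite size_drop size_map nth_drop => lt_o eq_t.
have lt_o' : c j + o < size (sequence j) by lia.
exists (pos j (c j + o)); first by rewrite mem_iota add0n pos_lt.
by rewrite rem_pos // ltnNge leq_addr /= -eq_t.
Qed.

Lemma has_don c t : 0 < t ->
  has (fun i => don_of c i == t) (iota 0 L)
  = [exists j, has (fun b => plt b == t) (take (c j) (sequence j))].
Proof.
move=> t_gt0; apply/hasP/existsP => [[i _ /eqP di]|[j /hasP[b q_b /eqP bt]]].
  have [j [o [lt_o lt_oc def_i]]] : exists j o,
    [/\ o < size (sequence j), o < c j & i = pos j o] by apply: don_gt0; rewrite di.
  exists j; have : t \in [seq plt b | b <- take (c j) (sequence j)].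
    rewrite -di def_i don_pos // lt_oc map_take.
    apply/(nthP 0); exists o; last by rewrite nth_take.
    by rewrite size_take_min size_map leq_min lt_oc.
  by case/mapP=> b q_b ->; apply/hasP; exists b.
have : t \in take (c j) [seq plt b | b <- sequence j].
  by rewrite -map_take -bt map_f.
case/(nthP 0)=> o; rewrite size_take_min size_map leq_min => /andP[lt_oc lt_o].
rewrite nth_take // => eq_t; exists (pos j o); first by rewrite mem_iota add0n pos_lt.
by rewrite don_pos // lt_oc -eq_t.
Qed.

Lemma is_openE c t : 0 < t -> is_open c t =
  has (fun i => don_of c i == t) (iota 0 L) && has (fun i => rem_of c i == t) (iota 0 L).
Proof.
move=> t_gt0; rewrite has_rem // has_don // /is_open.
apply/existsP/andP => [[j /existsP[l /andP[hj hl]]]|].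
  by split; apply/existsP; [exists j | exists l].
by case=> /existsP[j hj] /existsP[l hl]; exists j; apply/existsP; exists l; rewrite hj.
Qed.

(** * Effect of a removal on the layout and on the open pallets *)

Definition advance c j : config I := [ffun i => if i == j then (c j).+1 else c i].

(** Cells holding 0 are left out: there [rem_of] and [don_of] vanish whether or not the cell counts
    as gone. *)
Lemma gone_advance c j : c j < size (sequence j) ->
  forall i, 0 < cells i -> gone (advance c j) i = gone c i || (i == pos j (c j)).
Proof.
move=> lt_cj i /posP[j' [o [lt_o ->]]]; rewrite !gone_pos // ffunE.
have [eq_j|ne_j] := eqVneq j' j.
  rewrite eq_j in lt_o *.
  rewrite ltnS leq_eqVlt orbC; congr orb.
  by apply/eqP/eqP => [->|/(pos_inj lt_o lt_cj)[]].
suff -> : pos j' o == pos j (c j) = false by rewrite orbF.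
by apply: contraNF ne_j => /eqP /(pos_inj lt_o lt_cj)[-> _].
Qed.

Lemma rem_advance c j : c j < size (sequence j) ->
  rem_of (advance c j) = upd (rem_of c) (pos j (c j)) 0.
Proof.
move=> lt_cj; apply: functional_extensionality => i; rewrite /upd /rem_of.
have [c0|ci_gt0] := posnP (cells i); first by rewrite c0 !if_same.
by rewrite gone_advance //; case: (gone c i); case: eqP.
Qed.

Lemma don_advance c j : c j < size (sequence j) ->
  don_of (advance c j) = upd (don_of c) (pos j (c j)) (rem_of c (pos j (c j))).
Proof.
move=> lt_cj; apply: functional_extensionality => i; rewrite /upd /rem_of /don_of.
rewrite gone_pos // ltnn; have [->|ne_i] := eqVneq i (pos j (c j)).
  by rewrite gone_pos // ffunE eqxx ltnSn.
have [c0|ci_gt0] := posnP (cells i); first by rewrite c0 !if_same.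
by rewrite gone_advance // (negPf ne_i) orbF.
Qed.

(** Only the pallet [x] of the removed bin can change status. Before the step its bin remains, so
    [x] is open iff it occurs among the removed bins; after the step, iff it occurs among the
    remaining ones. *)
Lemma nopen_advance c j : c j < size (sequence j) ->
  nopen (advance c j) = nopen_after L (rem_of c) (don_of c) (pos j (c j)) (nopen c).
Proof.
move=> lt_cj; set i := pos j (c j); set c' := advance c j; set x := pallet j (c j).
have x_gt0 : 0 < x by exact: pallet_gt0.
have i_L : i \in iota 0 L by rewrite mem_iota add0n pos_lt.
have ri : rem_of c i = x by rewrite /i rem_pos // ltnn.
have di' : don_of c' i = x by rewrite don_advance // updE.
have open_x : is_open c x = has (fun i => don_of c i == x) (iota 0 L).
  by rewrite is_openE // andbC; case: hasP => // -[]; exists i; rewrite ?ri.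
have open_x' : is_open c' x = has (fun i => rem_of c' i == x) (iota 0 L).
  by rewrite is_openE //; case: hasP => // -[]; exists i; rewrite ?di'.
have pallets_gt0 t : t \in pallets I -> 0 < t.
  by rewrite mem_undup => /mapP[b /plt_gt0 b_gt0 ->].
have x_in : x \in pallets I.
  rewrite mem_undup map_flatten; apply/flattenP.
  exists [seq plt b | b <- sequence j]; last by rewrite mem_nth ?size_map.
  by rewrite map_f // mem_nth.
have uniq_pallets : uniq (pallets I) by exact: undup_uniq.
have [t t_in ne_tx|m [count_c' count_c]] :=
  count_distinguished (a := is_open c') (b := is_open c) uniq_pallets x_in.
  have t_gt0 := pallets_gt0 t t_in; rewrite !is_openE //.
  congr (_ && _); apply: eq_has => k.
    rewrite don_advance // -/i ri /upd; case: (eqVneq k i) => // ->.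
    by rewrite eq_sym (negPf ne_tx) /don_of gone_pos // ltnn (ltn_eqF t_gt0).
  rewrite rem_advance // -/i /upd; case: (eqVneq k i) => // ->.
  by rewrite ri (ltn_eqF t_gt0) eq_sym (negPf ne_tx).
rewrite /nopen_after ri /nopen count_c' count_c open_x open_x' rem_advance //.
by rewrite addKn addnC.
Qed.


(** * Correctness of the search *)

Lemma size_sequences : \sum_j size (@sequence I j) = nbins I.
Proof.
rewrite /nbins size_flatten sumnE big_map (big_nth [::]) big_mkord.
by apply: eq_bigr.
Qed.

Lemma stepP c c' :
  reflect (exists2 j, c j < size (sequence j) & c' = advance c j) (step c c').
Proof.
apply: (iffP existsP) => [[j /andP[lt_cj /eqP ->]]|[j lt_cj ->]]; exists j => //.
by rewrite lt_cj eqxx.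
Qed.

Lemma sum_advance c j : \sum_i advance c j i = (\sum_i c i).+1.
Proof.
rewrite (bigD1 j) //= [in RHS](bigD1 j) //= -addSn ffunE eqxx; congr (_ + _).
by apply: eq_bigr => i ne_ij; rewrite ffunE (negPf ne_ij).
Qed.

(** Induction on the number [k] of bins left. Only configurations after [c] are bounded, as [search]
    tests the bound after each removal. *)
Lemma search_correct k c :
    (forall j, c j <= size (sequence j)) -> \sum_j c j + k = nbins I ->
  search L (places I) k (rem_of c) (don_of c) (nopen c) <->
  exists s, [/\ path (@step I) c s, last c s = finish I
    & {in s, forall c', nopen c' <= places I}].
Proof.
elim: k c => [|k IHk] c le_c; rewrite -size_sequences => sum_c.
  split=> // _; exists [::]; split=> //=; apply/ffunP => j; rewrite ffunE.
  (* The totals agree and each term is bounded, so no sequence can have a bin left. *)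
  apply/eqP; rewrite eqn_leq le_c /= leqNgt; apply/negP => lt_cj.
  move: sum_c; rewrite addn0 (bigD1 j) //= [in RHS](bigD1 j) //=.
  have le_rest :
    \sum_(i | i != j) c i <= \sum_(i | i != j) size (@sequence I i).
    exact: leq_sum.
  by move=> eq_sum; have := leq_add lt_cj le_rest; rewrite -eq_sum addSn ltnn.
have next_c j : c j < size (sequence j) ->
    (forall i, advance c j i <= size (sequence i)) /\
    \sum_i advance c j i + k = nbins I.
  move=> lt_cj; rewrite sum_advance addSnnS sum_c size_sequences; split=> // i.
  by rewrite ffunE; case: eqP => [->|].
split=> [/hasP[i _ /and3P[rem_i le_p found]]|[[|c' s] [/= path_s last_s le_s]]].
- have [j [o [lt_o le_co def_i]]] : exists j o,
    [/\ o < size (sequence j), c j <= o & i = pos j o].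
    by apply: (@rem_gt0 c); case/andP: rem_i.
  have eq_o : o = c j by apply/eqP; rewrite -(removable_pos c lt_o) -def_i.
  rewrite eq_o in lt_o def_i; have [le_c' sum_c'] := next_c j lt_o.
  rewrite def_i -nopen_advance // -rem_advance // -don_advance // in le_p found.
  have [s [path_s last_s le_s]] := (IHk _ le_c' sum_c').1 found.
  exists (advance c j :: s); split=> //=.
    by rewrite path_s andbT; apply/stepP; exists j.
  by move=> c'; rewrite inE => /predU1P[->|/le_s].
(* An empty processing would make [c] final, although [k.+1] bins are left. *)
- have : \sum_j c j = \sum_j size (@sequence I j).
    by rewrite last_s; apply: eq_bigr => j _; rewrite ffunE.
  by lia.
have /andP[/stepP[j lt_cj def_c'] path_s'] := path_s.
have [le_c' sum_c'] := next_c j lt_cj.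
apply/hasP; exists (pos j (c j)); first by rewrite mem_iota add0n pos_lt.
rewrite removable_pos // eqxx -nopen_advance // -rem_advance // -don_advance //.
rewrite -def_c' in le_c' sum_c' *; rewrite le_s ?mem_head //=.
apply/(IHk _ le_c' sum_c'); exists s; split=> // d s_d.
by apply: le_s; rewrite inE s_d orbT.
Qed.

Lemma nopen_start : nopen (start I) = 0.
Proof.
apply/eqP; rewrite -leqn0 leqNgt -has_count; apply/hasPn => t _.
apply/existsPn => j; apply/existsPn => l.
by rewrite ffunE take0.
Qed.

Lemma rem_start : rem_of (start I) = nth 0 (layout Q).
Proof.
apply: functional_extensionality => i; rewrite /rem_of.
have [c0|/posP[j [o [lt_o ->]]]] := posnP (cells i).
  by rewrite c0 if_same; rewrite /cells in c0.
by rewrite gone_pos // ffunE.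
Qed.

Lemma don_start : don_of (start I) = fun=> 0.
Proof.
apply: functional_extensionality => i; rewrite /don_of.
have [->|/posP[j [o [lt_o ->]]]] := posnP (cells i); first by rewrite if_same.
by rewrite gone_pos // ffunE.
Qed.

Lemma search_solvable :
  search L (places I) (nbins I) (nth 0 (layout Q)) (fun=> 0) 0 <->
  stackup_solvable I.
Proof.
rewrite -rem_start -don_start -nopen_start.
apply: iff_trans (search_correct _ _) _.
- by move=> j; rewrite ffunE.
- by rewrite big1 // => j _; rewrite ffunE.
split=> [[s [path_s last_s le_s]]|[s [/andP[path_s /eqP last_s] le_s]]].
  exists s; split; first by rewrite /processing path_s last_s eqxx.
  by move=> c; rewrite inE => /predU1P[->|/le_s //]; rewrite nopen_start.
by exists s; split=> // c s_c; apply: le_s; rewrite inE s_c orbT.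
Qed.

End Configurations.

(** * Running time *)

(** Each nonempty sequence adds one separator to at least one bin. *)
Lemma size_layout Q : size (flatten Q) <= size (layout Q) <= 2 * size (flatten Q).
Proof.
elim: Q => //= -[|x q] Q /andP[IH1 IH2]; rewrite /layout /= ?size_cat -/(layout Q).
  by rewrite IH1.
by rewrite /=; lia.
Qed.

(** Each level multiplies by [L] and adds at most [76 * (L ^ 2 + L + 1)] times the power; both fit
    in the factor [L.+1 ^ 2]. *)
Lemma search_time_le L k : search_time L k <= 76 * (L.+1 ^ 2) ^ k.
Proof.
elim: k => [|k IHk] //=; rewrite expnS.
have : L * search_time L k <= L * (76 * (L.+1 ^ 2) ^ k) by rewrite leq_mul2l IHk orbT.
have : 0 < (L.+1 ^ 2) ^ k by rewrite !expn_gt0.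
by move: (_ ^ k) (search_time L k) => y t; rewrite -mulnn; nia.
Qed.

Lemma bitlen_bigmax s : bitlen (\max_(x <- s) x) <= (total_bitlen s).+1.
Proof.
elim: s => [|x s IHs]; first by rewrite big_nil.
rewrite big_cons; apply: leq_trans (bitlen_max _ _) _.
by rewrite /total_bitlen /= -addnS leq_add2l.
Qed.

Lemma runs_halt P b s : onth P (pc s) = Some (HALT b) -> runs P s b 1.
Proof. by move=> Ps; have := RunsHalt Ps; case: (s). Qed.

Lemma size_leq_total_bitlen s : size s <= total_bitlen s.
Proof. by elim: s => //= x s; rewrite /total_bitlen /=; have := bitlen_gt0 x; lia. Qed.

(** The summands are the 4 instructions before the first sequence, the reading of the tape, the
    search with its entry and exit, and the halting instruction. *)
Lemma stackup_ram_runs p Q (L := size (layout Q)) (n := size (flatten Q))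
    (M := bitlen (ptr L + 4)) (S := total_bitlen (p :: tape Q)) :
    all (all (leq 1)) Q ->
  exists2 t, t <= 16 * (S + M) + (96 + 48 * M) * S
                  + 4 * (S.+1 + M) * (2 + search_time L n + 3) + 1 &
    runs stackup_ram (init (p :: tape Q))
      (search L p n (nth 0 (layout Q)) (fun=> 0) 0) t.
Proof.
move=> Q_gt0; have /andP[le_nL _] := size_layout Q.
(* This bounds the numbers on the tape and the addresses, and its bit length is at most
   [S.+1 + M]. *)
set B := maxn (\max_(x <- p :: tape Q) x) (ptr L + 4).
have le_LB : ptr L + 4 <= B by rewrite leq_maxr.
have le_tape x : x \in p :: tape Q -> x <= B.
  by move=> s_x; rewrite leq_max (leq_bigmax_seq (F := id)).
have le_pB : p <= B by rewrite le_tape ?mem_head.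
have le_bB : bitlen B <= S.+1 + M.
  apply: leq_trans (bitlen_max _ _) _; rewrite leq_add2r; exact: bitlen_bigmax.
have le_LB' : 16 + 4 * L <= B by move: le_LB; rewrite /ptr /nreg; lia.
have start_reading : reach stackup_ram (16 * (S + M)) (init (p :: tape Q))
    (reading p pc_seq (ptr 0) 0 [::] 0 (tape Q)).
  apply: reachW (_ : 4 * (bitlen p + M) * 4 <= _) _.
    by rewrite /S /total_bitlen /=; lia.
  pose B1 := maxn p (ptr L + 4); have le_pB1 : p <= B1 by rewrite leq_maxl.
  have le_LB1 : 16 + 4 * L <= B1.
    by apply: leq_trans (leq_maxr _ _); rewrite /ptr /nreg; lia.
  apply: (@reachB B1); first exact: bitlen_max.
  rewrite /init mk0 /reading (_ : nth 0 [::] = fun=> 0); last first.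
    by apply: functional_extensionality => j; rewrite nth_nil.
  by do 4 sym; apply: nsteps_refl.
have [||a read_Q] := @read_tape L p Q (ptr 0) 0 [::] 0 Q_gt0.
- by [].
- by [].
have rem_le j : nth 0 (layout Q) j <= B.
  have [lt_j|le_j] := ltnP j (size (layout Q)); last by rewrite nth_default.
  have /flattenP[bl /mapP[q0 Q_q0 ->]] := mem_nth 0 lt_j.
  case: q0 Q_q0 => // x q Q_q; rewrite inE => /predU1P[-> //|q_x].
  apply: le_tape; rewrite inE /tape mem_cat; apply/orP; right; apply/orP; left.
  apply/flattenP; exists (1 :: rcons (x :: q) 0); first by rewrite map_f.
  by rewrite inE mem_rcons !inE -in_cons q_x !orbT.
pose F : fields := (nth 0 (layout Q), fun=> 0, fun=> 0, fun=> 0).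
have [s0 enter s0_enter] : exists2 s0,
    nsteps stackup_ram B 2 (reading p pc_main a 0 (layout Q) n [::]) s0 &
    at_level L n p [::] pc_enter 0 F s0.
  eexists; first by rewrite /reading; do 2 sym; apply: nsteps_refl.
  by do 8 eexists.
have legal0 : legal B (nth 0 (layout Q)) (fun=> 0).
  by split=> //; elim: (Q) => // -[|x q].
rewrite /F -{1}(subnn n) in s0_enter.
have [//|s1 search_n out_n] := search_run le_LB le_nL le_pB (leqnn n) legal0 _ s0_enter.
have reach_s1 := reach_trans start_reading (reach_trans read_Q
  (reachB le_bB (nsteps_trans enter search_n))).
rewrite subnn in out_n.
set found := search _ _ _ _ _ _ in out_n *.
have [s2 halt_n pc_s2] : exists2 s2, nsteps stackup_ram B 3 s1 s2 &
    pc s2 = if found then pc_accept else pc_reject.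
  case: found out_n => [pc_s1|[D' [C' [_ _ /back_reject back]]]].
    by exists s1 => //; apply: nsteps_refl.
  exact: back le_LB le_nL le_pB.
have [t le_t run_t] := reach_trans reach_s1 (reachB le_bB halt_n).
exists (t + 1); last first.
  apply: run_t; apply: runs_halt; rewrite pc_s2; by case: (found).
rewrite leq_add2r; apply: leq_trans le_t _.
rewrite /S /total_bitlen /= -/(total_bitlen _) -/M.
have : 48 * M * size (tape Q) <= 48 * M * total_bitlen (tape Q).
  by rewrite leq_mul2l size_leq_total_bitlen orbT.
by move: (total_bitlen _) (size (tape Q)) (search_time _ _) (bitlen p) => u v st b; lia.
Qed.

(** With [Y = X ^ (n ^ 2)], the address length [M] is at most [17 * Y], being linear in [n], and the
    search time at most [76 * Y ^ 2], because [L.+1 <= X] and [n <= n ^ 2]. Their product gives the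
    exponent [3 * n ^ 2]. *)
Lemma time_bound L n S (X := 4 * n ^ 2 + 1) (M := bitlen (ptr L + 4)) :
    L <= 2 * n -> 0 < S ->
  16 * (S + M) + (96 + 48 * M) * S + 4 * (S.+1 + M) * (2 + search_time L n + 3) + 1
  <= 80 * 100 * (S * X ^ (3 * n ^ 2)).
Proof.
move=> le_L S_gt0; set Y := X ^ (n ^ 2).
have X_gt0 : 0 < X by rewrite /X addn1.
have Y_gt0 : 0 < Y by rewrite expn_gt0 X_gt0.
have le_nn : n <= n ^ 2 by rewrite -mulnn; nia.
have le_M : M <= 17 * Y.
  have: M <= 17 + 8 * n.
    by apply: leq_trans (bitlen_leS _) _; rewrite /ptr /nreg; lia.
  case: (posnP n) => [n0|n_gt0]; first by move: Y_gt0; lia.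
  have: X <= Y by rewrite -{1}[X]expn1 leq_exp2l ?expn_gt0 ?n_gt0 // /X; lia.
  by rewrite /X; lia.
have le_search : search_time L n <= 76 * (Y * Y).
  apply: leq_trans (search_time_le _ _) _; rewrite leq_mul2l /= -expnM.
  apply: leq_trans (_ : X ^ (2 * n) <= _).
    case: (posnP n) => [->//|n_gt0]; rewrite leq_exp2r ?muln_gt0 //.
    by rewrite /X; lia.
  by rewrite -expnD leq_pexp2l //; lia.
have -> : X ^ (3 * n ^ 2) = Y * Y * Y by rewrite -!expnD; congr (_ ^ _); lia.
have le_S : S <= S * Y by rewrite leq_pmulr.
have le_Y : Y <= S * Y by rewrite leq_pmull.
have le_Z : S * Y <= S * (Y * Y * Y).
  by rewrite leq_mul2l -mulnA leq_pmulr ?orbT // muln_gt0 Y_gt0.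
have le_MS : M * S <= 17 * (S * Y).
  by rewrite [S * Y]mulnC mulnA leq_mul2r le_M orbT.
have le_Y2 : 0 < Y * Y by rewrite muln_gt0 Y_gt0.
(* Here 19 = 1 + 1 + 17 bounds [S.+1 + M], and 81 = 76 + 5 the number of instructions. *)
have le_main : (S.+1 + M) * (2 + search_time L n + 3) <= 19 * (S * Y) * (81 * (Y * Y)).
  by apply: leq_mul; lia.
have eq_main : 19 * (S * Y) * (81 * (Y * Y)) = 1539 * (S * (Y * Y * Y)) by lia.
by move: le_Z le_main eq_main; move: (S * (Y * Y * Y)) (S.+1 + M) (2 + _ + 3); nia.
Qed.

Lemma tapeE (I : fifo_instance) :
  encode I = places I :: tape [seq [seq plt b | b <- q] | q <- seqs I].
Proof. by rewrite /tape -map_comp. Qed.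

Theorem theorem13 :
  exists (P : program) (C d : nat), forall I : fifo_instance,
  exists (b : bool) (t : nat),
    [/\ runs P (init (encode I)) b t,
        b <-> stackup_solvable I
      & t <= C * (instance_size I * (4 * nbins I ^ 2 + 1) ^ (d * nbins I ^ 2))].
Proof.
exists stackup_ram, (80 * 100), 3 => I.
set Q := [seq [seq plt b | b <- q] | q <- seqs I].
have size_Q : size (flatten Q) = nbins I by rewrite -map_flatten size_map.
have Q_gt0 : all (all (leq 1)) Q.
  apply/allP => _ /mapP[q I_q ->]; apply/allP => _ /mapP[b q_b ->].
  by apply: plt_gt0; apply/flattenP; exists q.
have size_I : instance_size I = total_bitlen (places I :: tape Q).
  by rewrite /instance_size tapeE /total_bitlen sumnE big_map.
have [t le_t run_t] := stackup_ram_runs (places I) Q_gt0.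
rewrite -tapeE size_Q in run_t.
exists (search (size (layout Q)) (places I) (nbins I) (nth 0 (layout Q)) (fun=> 0) 0), t.
split; [exact: run_t | exact: search_solvable |].
rewrite -size_I size_Q in le_t; apply: leq_trans le_t _.
apply: time_bound; first by rewrite -size_Q; case/andP: (size_layout Q).
by rewrite size_I /total_bitlen /=; have := bitlen_gt0 (places I); lia.
Qed.
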